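(* Let $a>0$, $\alpha>-1$, $0<t<T$. Let $(B_k)_{k\ge 0}$ be the monic polynomials generated by the recurrence $$xB_k(x)=B_{k+1}(x)+b_kB_k(x)+c_kB_{k-1}(x)+d_kB_{k-2}(x),\qquad k\ge 0,$$ with $B_0\equiv 1$, $B_{-1}\equiv B_{-2}\equiv 0$ and recurrence coefficients $$b_k=\frac{a(T-t)^2}{T^2}+\frac{2t(T-t)}{T}(2k+\alpha+1),$$ $$c_k=\frac{4at(T-t)^3}{T^3}k+\frac{4t^2(T-t)^2}{T^2}k(k+\alpha),$$ $$d_k=\frac{4at^2(T-t)^4}{T^4}k(k-1).$$ Then the polynomials $B_k$ have real and simple zeros in $(0,\infty)$ with the interlacing property.
   Context: The interlacing property means: if $x_1^{k}<\cdots<x_k^{k}$ denote the zeros of $B_k$, then for every $k\ge 1$ one has $x_j^{k+1}<x_j^{k}<x_{j+1}^{k+1}$ for $j=1,\ldots,k$. *)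

(* Defs.v *)
From HB Require Import structures.
From mathcomp Require Import all_boot all_order all_algebra.
From mathcomp Require Import reals.
From mathcomp Require Import polyrcf complex.

Set Implicit Arguments.
Unset Strict Implicit.
Unset Printing Implicit Defensive.

Import Order.TTheory GRing.Theory Num.Theory.
Local Open Scope ring_scope.

Section RecurrenceCoefficients.
Context {R : realType}.
Variables (a alpha t T : R).

Definition coef_b (k : nat) : R :=
  a * (T - t) ^+ 2 / T ^+ 2
  + 2 * t * (T - t) / T * (2 * k%:R + alpha + 1).

Definition coef_c (k : nat) : R :=
  4 * a * t * (T - t) ^+ 3 / T ^+ 3 * k%:R
  + 4 * t ^+ 2 * (T - t) ^+ 2 / T ^+ 2 * k%:R * (k%:R + alpha).

Definition coef_d (k : nat) : R :=
  4 * a * t ^+ 2 * (T - t) ^+ 4 / T ^+ 4 * k%:R * (k%:R - 1).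

End RecurrenceCoefficients.

(* The sequence is indexed by [int] so that B_{-1} and B_{-2} make sense;
   only its values at indices >= -2 are constrained.  Monicity of B_k, k >= 0,
   follows from the recurrence. *)
Definition generated_by_recurrence (R : realType) (b c d : nat -> R)
    (B : int -> {poly R}) : Prop :=
  [/\ B 0 = 1, B (-1) = 0, B (-2) = 0 &
      forall k : nat,
        'X * B k%:Z = B (k%:Z + 1) + b k *: B k%:Z
                      + c k *: B (k%:Z - 1) + d k *: B (k%:Z - 2)].

(* All complex zeros are considered, so that realness has content. *)
Definition real_simple_positive_zeros (R : realType) (p : {poly R}) : Prop :=
  let pC : {poly R[i]} := map_poly (real_complex R) p in
  forall z : R[i], root pC z ->
    mup z pC = 1%N /\ (exists2 x : R, 0 < x & z = real_complex R x).

(* [rootsR p] is the strictly increasing list of the distinct real zeros of p;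
   x_j^k is its entry of index j - 1 for p = B_k.  The size condition says that
   there are indeed k of them, so no default value is ever used. *)
Definition interlacing_property (R : realType) (B : nat -> {poly R}) : Prop :=
  (forall k : nat, (1 <= k)%N -> size (rootsR (B k)) = k) /\
  (forall k j : nat, (1 <= k)%N -> (1 <= j <= k)%N ->
     let x (k j : nat) : R := (rootsR (B k))`_(j - 1) in
     x k.+1 j < x k j < x k.+1 j.+1).

(* Main.v *)
Require Import Defs.
From HB Require Import structures.
From mathcomp Require Import all_boot all_order all_algebra.
From mathcomp Require Import reals.
From mathcomp Require Import polyrcf complex.
From mathcomp Require Import zify ring lra.

Set Implicit Arguments.
Unset Strict Implicit.
Unset Printing Implicit Defensive.

Import Order.TTheory GRing.Theory Num.Theory.
Local Open Scope ring_scope.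

(** Put [tau = 2 t (T - t) / T], [beta = a (T - t)^2 / T^2] and write [P_k] for
    [B_k].  The banded matrix of the four-term recurrence is a product of three
    bidiagonal matrices with positive entries.  In terms of polynomials, there
    are two auxiliary monic sequences [Q_k], [N_k] of degree [k] such that
      [P_k = Q_k + tau k Q_(k-1)],
      [Q_k = N_k + s_k N_(k-1)],
      [x N_k = P_(k+1) + r_k P_k],
    with [s_k > 0] for [k > 0] and [r_k > 0].  The first relation defines [Q]
    and the second one [N]; the third one is then a consequence of the
    recurrence ([peel_three_term], [peel_two_term]) provided that
    [s_k r_(k-1) = tau beta k] and [r_k + s_k = beta + tau (k + alpha + 1)].
    These equations determine [r] from [r_0 = beta + tau (alpha + 1)], and
    [r_k > beta] follows by induction ([bidiag_coef_gt]).

    Consequently the members of [P_0, Q_0, N_0, P_1, Q_1, N_1, ...] from [P_1]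
    on satisfy [u_(n+1) = x^e u_n - a u_(n-2)] with [a > 0], where [e] is 1 when
    a [P] is produced and 0 otherwise. Three consecutive members have positive
    simple zeros which pairwise interlace, and this property propagates
    ([interlaced_chain]). Indeed the right-hand side has an evident sign at
    each zero of the three old members: at a zero of [u_n] or of [u_(n-2)]
    only one term is left, and at a zero of [u_(n-1)] both terms have the same
    sign because [u_(n-2)] and [u_n] lie on opposite sides of [u_(n-1)]. These
    signs alternate from one zero to the next, so the intermediate value
    theorem places the zeros of [u_(n+1)] between the old ones
    ([interlaced3_step]). Since [P_k] and [P_(k+1)] are three steps apart, the
    interlacing of [u_(n-2)] with [u_(n+1)] is the claim. *)

(** * Polynomials with interlacing positive zeros *)

Definition prod_roots (R : nzRingType) (s : seq R) : {poly R} :=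
  \prod_(z <- s) ('X - z%:P).

Lemma size_prod_roots (R : rcfType) (s : seq R) :
  size (prod_roots s) = (size s).+1.
Proof. exact: size_prod_XsubC. Qed.

Lemma monic_prod_roots (R : rcfType) (s : seq R) : prod_roots s \is monic.
Proof. exact: monic_prod_XsubC. Qed.

Definition pos_decr (R : rcfType) (s : seq R) : bool :=
  sorted >%R s && all (> 0) s.

(** With zeros listed in decreasing order, the two cases [size t = size s] and
    [size t = size s + 1] obey the same inequalities, the largest zero being
    always the head of [t]. *)
Definition interlaced (R : rcfType) (s t : seq R) : Prop :=
  [/\ (size s <= size t <= (size s).+1)%N,
      forall i, (i < size s)%N -> s`_i < t`_i &
      forall i, (i.+1 < size t)%N -> t`_i.+1 < s`_i].

(** Each zero above [x] contributes one negative factor. *)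
Lemma prod_roots_sign (R : rcfType) (s : seq R) (x : R) (i : nat) :
  (i <= size s)%N ->
  (forall j, (j < i)%N -> x < s`_j) ->
  (forall j, (i <= j < size s)%N -> s`_j < x) ->
  0 < (-1) ^+ i * (prod_roots s).[x].
Proof.
rewrite /prod_roots; elim: s i => [|z s IHs] [|i] //= le_is above below.
- by rewrite big_nil hornerC mul1r ltr01.
- rewrite big_cons hornerM hornerXsubC mulrCA mulr_gt0 //.
    by rewrite subr_gt0 (below 0%N).
  by apply: IHs => // j ltjs; apply: (below j.+1).
- rewrite big_cons hornerM hornerXsubC exprS mulrACA mulr_gt0 //.
    by rewrite mulN1r opprB subr_gt0 (above 0%N).
  by apply: IHs => // j ltj; [apply: (above j.+1) | apply: (below j.+1)].
Qed.

Lemma nth_decr_le (R : rcfType) (s : seq R) (i j : nat) :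
  pos_decr s -> (i <= j < size s)%N -> s`_j <= s`_i.
Proof.
case/andP=> s_decr _ /andP[]; rewrite leq_eqVlt => /predU1P[->//|ltij] ltjs.
apply: ltW; apply: (sorted_ltn_nth _ 0 s_decr) => //.
  exact: rev_trans lt_trans.
by rewrite inE (ltn_trans ltij).
Qed.

Lemma nth_pos_decr_gt0 (R : rcfType) (s : seq R) (i : nat) :
  pos_decr s -> (i < size s)%N -> 0 < s`_i.
Proof. by case/andP=> _ /all_nthP; apply. Qed.

Lemma nth_pos_decr_ge0 (R : rcfType) (s : seq R) (i : nat) :
  pos_decr s -> 0 <= s`_i.
Proof.
move=> s_pd; case: (ltnP i (size s)) => [/nth_pos_decr_gt0/ltW-> //|].
by move/(nth_default 0)->.
Qed.

(** Beyond the end of [t], the value [t`_i] is the default [0], which lies below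
    all zeros of a [pos_decr] list; thus for [i = size t] this is the sign of
    the polynomial at the origin.  The same convention is used in the lemmas
    below, where the origin serves as one more lower end point. *)
Lemma interlaced_sign_lower (R : rcfType) (s t : seq R) (i : nat) :
  pos_decr s -> pos_decr t -> interlaced s t -> (i <= size s)%N ->
  0 < (-1) ^+ i * (prod_roots s).[t`_i].
Proof.
move=> s_pd t_pd [/andP[le_st le_ts] lt_st lt_ts] le_is.
apply: prod_roots_sign => // j.
  move=> ltji; have ltjs : (j < size s)%N by apply: leq_trans le_is.
  case: (ltnP i (size t)) => [ltit | leti].
    case: i ltji ltit le_is => // i ltji ltit le_is.
    by apply: (lt_le_trans (lt_ts i ltit)); apply: nth_decr_le => //; lia.
  by rewrite (nth_default 0 leti) nth_pos_decr_gt0.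
move=> /andP[leij ltjs].
apply: (@le_lt_trans _ _ s`_i); first by apply: nth_decr_le => //; lia.
by apply: lt_st; apply: leq_ltn_trans ltjs.
Qed.

Lemma interlaced_sign_upper (R : rcfType) (s t : seq R) (i : nat) :
  pos_decr s -> pos_decr t -> interlaced s t -> (i < size t)%N ->
  0 < (-1) ^+ i.+1 * (prod_roots t).[s`_i].
Proof.
move=> s_pd t_pd [/andP[le_st le_ts] lt_st lt_ts] ltit.
apply: prod_roots_sign => // j.
  move=> leji; case: (ltnP i (size s)) => [ltis | lesi].
    by apply: (lt_le_trans (lt_st i ltis)); apply: nth_decr_le => //; lia.
  rewrite (nth_default 0 lesi) nth_pos_decr_gt0 //.
  exact: leq_ltn_trans ltit.
move=> /andP[ltij ltjt].
apply: (@le_lt_trans _ _ t`_i.+1); first by apply: nth_decr_le => //; lia.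
by apply: lt_ts; apply: leq_ltn_trans ltjt.
Qed.

(** There are as many sign changes as the degree, so the zeros provided by the
    intermediate value theorem exhaust all zeros. *)
Lemma roots_from_alternation (R : rcfType) (n : nat) (g : {poly R})
    (y : nat -> R) :
  g \is monic -> size g = n.+1 ->
  (forall i, (i < n)%N -> y i.+1 < y i) ->
  (forall i, (i <= n)%N -> 0 < (-1) ^+ i * g.[y i]) ->
  exists w : seq R,
    [/\ size w = n, sorted >%R w, g = prod_roots w &
        forall i, (i < n)%N -> y i.+1 < w`_i < y i].
Proof.
move=> g_monic size_g y_decr y_sign.
have root_in (i : 'I_n) : exists z, root g z && (y i.+1 < z < y i).
  have lt_in := ltn_ord i.
  have sgn : g.[y i.+1] * g.[y i] < 0.
    have := mulr_gt0 (y_sign i (ltnW lt_in)) (y_sign i.+1 lt_in).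
    rewrite mulrACA -exprD addnS exprS -signr_odd addnn odd_double.
    by rewrite mulr1 mulN1r oppr_gt0 mulrC.
  have [z] := poly_ivtoo (ltW (y_decr i lt_in)) sgn.
  by rewrite in_itv /= => zin rz; exists z; rewrite rz.
have [f fP] := fin_all_exists root_in.
pose w := [seq f i | i : 'I_n].
have size_w : size w = n by rewrite size_map size_enum_ord.
have nth_w i (lt_in : (i < n)%N) : w`_i = f (Ordinal lt_in).
  rewrite (nth_map (Ordinal lt_in)) ?size_enum_ord //.
  by congr f; apply: val_inj; rewrite /= nth_enum_ord.
have w_between i : (i < n)%N -> y i.+1 < w`_i < y i.
  by move=> lt_in; rewrite nth_w; case/andP: (fP (Ordinal lt_in)).
have w_sorted : sorted >%R w.
  apply/(sortedP 0) => i; rewrite size_w => lt_in.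
  have /andP[_ lt1] := w_between _ lt_in.
  have /andP[lt2 _] := w_between _ (ltnW lt_in).
  exact: lt_trans lt1 lt2.
exists w; split=> //.
rewrite [LHS](all_roots_prod_XsubC (rs := w)).
- by rewrite (monicP g_monic) scale1r.
- by rewrite size_w.
- by apply/allP => _ /mapP[i _ ->]; case/andP: (fP i).
- by rewrite uniq_rootsE; apply: (sorted_uniq (rev_trans lt_trans) (@ltxx _ R)).
Qed.

(** The sign condition concerns the elements of [s] and, when
    [n = size s + 1], also the origin, which is the default value
    [s`_(size s)]; it produces one zero just above each element of [s] (the largest one
    because a monic polynomial tends to infinity) and, in the second case,
    one more just above the origin. *)
Lemma interlacing_criterion (R : rcfType) (s : seq R) (n : nat) (g : {poly R}) :
  pos_decr s -> (size s <= n <= (size s).+1)%N ->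
  g \is monic -> size g = n.+1 ->
  (forall i, (i < n)%N -> 0 < (-1) ^+ i.+1 * g.[s`_i]) ->
  exists w : seq R,
    [/\ size w = n, pos_decr w, g = prod_roots w & interlaced s w].
Proof.
move=> s_pd size_s g_monic size_g g_sign.
have [M gM] : exists M, forall x, M <= x -> 1 <= g.[x].
  have [|M gM] := @poly_pinfty_gt_lc _ g.
    by rewrite (monicP g_monic) ltr01.
  by exists M => x /gM; rewrite (monicP g_monic).
(* The right end point exceeds the largest element of [s] and is positive
   when [s] is empty; every [y i] with [i > size s] is the origin. *)
pose y i := (Num.max M (1 + head 0 s) :: s)`_i.
have y_decr i : (i < n)%N -> y i.+1 < y i.
  rewrite /y; case: i => [_|i lt_in] /=.
    by rewrite lt_max nth0 ltrDr ltr01 orbT.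
  case: (ltnP i.+1 (size s)) => [lt_is | le_si].
    by case/andP: s_pd => /(sortedP 0)/(_ i lt_is).
  rewrite (nth_default 0 le_si) nth_pos_decr_gt0 //; lia.
have [|w [size_w w_sorted def_g w_between]] :=
    roots_from_alternation g_monic size_g y_decr.
  case=> [_|i lt_in]; last exact: g_sign.
  by rewrite mul1r (lt_le_trans ltr01) // gM // le_max lexx.
exists w; split=> //.
  rewrite /pos_decr w_sorted; apply/(all_nthP 0) => i; rewrite size_w => lt_in.
  have /andP[lt_sw _] := w_between i lt_in.
  exact: le_lt_trans (nth_pos_decr_ge0 i s_pd) lt_sw.
split=> [|i lt_is|i]; rewrite ?size_w //.
  by have /andP[] := w_between i (leq_trans lt_is (proj1 (andP size_s))).
by move=> /w_between/andP[].
Qed.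

Lemma prod_roots_inj (R : rcfType) (s t : seq R) :
  pos_decr s -> pos_decr t -> prod_roots s = prod_roots t -> s = t.
Proof.
move=> /andP[s_sorted _] /andP[t_sorted _] eq_st.
apply: (irr_sorted_eq (rev_trans lt_trans) (@ltxx _ R)) => // z.
by rewrite -!root_prod_XsubC -/(prod_roots s) eq_st.
Qed.

(** Transfers the criterion to a list [w] already known to carry the zeros: the
    list that the criterion yields has the same elements in the same order. *)
Lemma interlaced_of_signs (R : rcfType) (s w : seq R) :
  pos_decr s -> pos_decr w -> (size s <= size w <= (size s).+1)%N ->
  (forall i, (i < size w)%N -> 0 < (-1) ^+ i.+1 * (prod_roots w).[s`_i]) ->
  interlaced s w.
Proof.
move=> s_pd w_pd size_sw w_sign.
have [||w' [_ w'_pd eq_w s_w']] :=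
    interlacing_criterion s_pd size_sw _ _ w_sign.
- exact: monic_prod_roots.
- exact: size_prod_roots.
- by rewrite (prod_roots_inj w_pd w'_pd eq_w).
Qed.

(** * Propagation along the recurrence u_(n+1) = x^e u_n - a u_(n-2) *)

Definition interlaced3 (R : rcfType) (s t v : seq R) : Prop :=
  [/\ [/\ pos_decr s, pos_decr t & pos_decr v],
      interlaced s t, interlaced t v & interlaced s v].

(** The size equation forces [e = true] when [s] and [v] have the same length,
    and [e = false] when [v] has one more zero; the new polynomial always has
    one zero more than the one it is subtracted from. *)
Lemma interlaced3_step (R : rcfType) (s t v : seq R) (e : bool) (a : R) :
  0 < a -> interlaced3 s t v -> (size v + e = (size s).+1)%N ->
  exists w : seq R,
    [/\ size w = (size s).+1,
        'X^e * prod_roots v - a *: prod_roots s = prod_roots w,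
        interlaced3 t v w & interlaced s w].
Proof.
move=> a_gt0 [[s_pd t_pd v_pd] st tv sv] size_ve.
have [/andP[le_st le_ts] _ _] := st; have [/andP[le_tv le_vt] _ _] := tv.
set g := _ - _.
have size_Xv : size ('X^e * prod_roots v) = (size s).+2.
  rewrite size_monicM ?monicXn -?size_poly_eq0 ?size_prod_roots //.
  by rewrite size_polyXn; lia.
have size_as : (size (- (a *: prod_roots s)) < size ('X^e * prod_roots v)%R)%N.
  rewrite size_Xv size_polyN (leq_ltn_trans (size_scale_leq _ _)) //.
  by rewrite size_prod_roots.
have size_g : size g = (size s).+2 by rewrite size_polyDl.
have g_monic : g \is monic.
  rewrite monicE lead_coefDl // -monicE monicMl ?monicXn //.
  exact: monic_prod_roots.
(* Both summands turn out to be nonnegative at the zeros of [s], [t] and [v],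
   and one of them is positive. *)
have g_sign x i : (-1) ^+ i.+1 * g.[x] =
    x ^+ e * ((-1) ^+ i.+1 * (prod_roots v).[x])
    + a * ((-1) ^+ i * (prod_roots s).[x]).
  by rewrite /g hornerD hornerN hornerZ hornerM hornerXn exprS; ring.
have [|i lt_i|w [size_w w_pd def_g vw]] :=
    interlacing_criterion (n := (size s).+1) v_pd _ g_monic size_g.
- lia.
- rewrite g_sign ltr_wpDl //; last first.
    by rewrite mulr_gt0 // interlaced_sign_lower.
  case: (ltnP i (size v)) => [lt_iv | le_vi].
    suff /rootP->: root (prod_roots v) v`_i by rewrite !mulr0.
    by rewrite root_prod_XsubC mem_nth.
  have -> : e = true by lia.
  by rewrite (nth_default 0 le_vi) expr1 mul0r.
have tw : interlaced t w.
  apply: interlaced_of_signs => //; first by rewrite size_w; lia.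
  move=> i; rewrite size_w -def_g => lt_i.
  rewrite g_sign ltr_wpDl //; last by rewrite mulr_gt0 // interlaced_sign_lower.
  case: (ltnP i (size v)) => [lt_iv | le_vi].
    rewrite mulr_ge0 ?exprn_ge0 ?nth_pos_decr_ge0 // ltW //.
    exact: interlaced_sign_upper.
  have -> : e = true by lia.
  by rewrite (nth_default 0 (leq_trans le_tv le_vi)) expr1 mul0r.
exists w; split=> //.
apply: interlaced_of_signs => //; first by rewrite size_w; lia.
move=> i; rewrite size_w -def_g => lt_i; rewrite g_sign.
case: (ltnP i (size s)) => [lt_is | le_si].
  have /rootP-> : root (prod_roots s) s`_i.
    by rewrite root_prod_XsubC mem_nth.
  rewrite !mulr0 addr0 mulr_gt0 ?exprn_gt0 ?nth_pos_decr_gt0 //.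
  apply: interlaced_sign_upper => //; lia.
have -> : i = size s by lia.
rewrite (nth_default 0 (leqnn (size s))) ltr_wpDl //; last first.
  rewrite mulr_gt0 //; apply: prod_roots_sign => // j; last lia.
  exact: nth_pos_decr_gt0.
case: (ltnP (size s) (size v)) => [lt_sv | le_vs].
  rewrite mulr_ge0 ?exprn_ge0 // ltW //.
  rewrite -[X in _.[X]](nth_default 0 (leqnn (size s))).
  exact: interlaced_sign_upper.
have -> : e = true by lia.
by rewrite expr1 mul0r.
Qed.

(** Each round applies [interlaced3_step] three times, once with [e = true] and
    twice with [e = false]; the triple starts from three constants, whose
    interlacing is vacuous.  The extra interlacing that the step producing
    [P_(k+1)] gives with the oldest member [P_k] is the conclusion. *)
Lemma interlaced_chain (R : rcfType) (P Q N : nat -> {poly R})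
    (q s r : nat -> R) :
  (forall k, 0 < q k) -> (forall k, 0 < s k) -> (forall k, 0 < r k) ->
  P 0 = 1 -> Q 0 = 1 -> N 0 = 1 ->
  (forall k, P k.+1 = 'X * N k - r k *: P k) ->
  (forall k, Q k.+1 = P k.+1 - q k *: Q k) ->
  (forall k, N k.+1 = Q k.+1 - s k *: N k) ->
  forall k, exists u w : seq R,
    [/\ size u = k /\ size w = k.+1, P k = prod_roots u, P k.+1 = prod_roots w,
        pos_decr u /\ pos_decr w & interlaced u w].
Proof.
move=> q_gt0 s_gt0 r_gt0 P0 Q0 N0 PS QS NS.
have chain k : exists u t v : seq R,
    [/\ [/\ size u = k, size t = k & size v = k],
        [/\ P k = prod_roots u, Q k = prod_roots t & N k = prod_roots v] &
        interlaced3 u t v].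
  elim: k => [|k [u [t [v [[size_u size_t size_v] [defP defQ defN] utv]]]]].
    by exists [::], [::], [::]; rewrite P0 Q0 N0 /prod_roots big_nil.
  have [|u' [size_u' def_u' tvu' _]] :=
      @interlaced3_step _ _ _ _ true _ (r_gt0 k) utv.
    by rewrite size_u size_v addn1.
  have [|t' [size_t' def_t' vut' _]] :=
      @interlaced3_step _ _ _ _ false _ (q_gt0 k) tvu'.
    by rewrite addn0 size_u' size_u size_t.
  have [|v' [size_v' def_v' utv' _]] :=
      @interlaced3_step _ _ _ _ false _ (s_gt0 k) vut'.
    by rewrite addn0 size_t' size_t size_v.
  have defP' : P k.+1 = prod_roots u' by rewrite PS defN defP -def_u' expr1.
  have defQ' : Q k.+1 = prod_roots t'.
    by rewrite QS defP' defQ -def_t' expr0 mul1r.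
  have defN' : N k.+1 = prod_roots v'.
    by rewrite NS defQ' defN -def_v' expr0 mul1r.
  exists u', t', v'; split=> //.
  by rewrite size_u' size_t' size_v' size_u size_t size_v.
move=> k.
have [u [t [v [[size_u size_t size_v] [defP _ defN] utv]]]] := chain k.
have [|w [size_w def_w [[_ _ w_pd] _ _ _] uw]] :=
    @interlaced3_step _ _ _ _ true _ (r_gt0 k) utv.
  by rewrite size_u size_v addn1.
exists u, w; split=> //; first by rewrite size_w size_u.
  by rewrite PS defN defP -def_w expr1.
by split=> //; case: utv => [[]].
Qed.

(** * Bidiagonal factorization of the four-term recurrence *)

(** Solves [P_k = S_k + c_k S_(k-1)] for the sequence [S], that is, removes one
    bidiagonal factor. *)
Fixpoint peel (R : rcfType) (c : nat -> R) (P : nat -> {poly R}) (k : nat)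
    : {poly R} :=
  if k is k'.+1 then P k - c k *: peel c P k' else P 0.

(** The pivots of the LU factorization of the tridiagonal matrix with diagonal
    entries [beta + tau (k + alpha + 1)], subdiagonal entries [tau beta k] and
    superdiagonal entries [1]. *)
Fixpoint bidiag_coef (R : rcfType) (alpha beta tau : R) (k : nat) : R :=
  if k is k'.+1 then
    beta + tau * (k%:R + alpha + 1)
      - tau * beta * k%:R / bidiag_coef alpha beta tau k'
  else beta + tau * (alpha + 1).

(** The bound by [beta], rather than by [0], is what makes the induction work:
    then the subtracted quotient is less than [tau k]. *)
Lemma bidiag_coef_gt (R : rcfType) (alpha beta tau : R) (k : nat) :
  -1 < alpha -> 0 < beta -> 0 < tau -> beta < bidiag_coef alpha beta tau k.
Proof.
move=> halpha beta_gt0 tau_gt0.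
have gap_gt0 : 0 < tau * (alpha + 1) by rewrite mulr_gt0 // -ltrBlDr sub0r.
elim: k => [|k IHk]; first by rewrite /= ltrDl.
rewrite [bidiag_coef _ _ _ _]/=; set r := bidiag_coef _ _ _ _ in IHk *.
have r_gt0 : 0 < r := lt_trans beta_gt0 IHk.
have : tau * beta * k.+1%:R / r < tau * k.+1%:R.
  rewrite ltr_pdivrMr // mulrAC ltr_pM2l ?mulr_gt0 ?ltr0n //.
lra.
Qed.

(** In [x Q_k = x P_k - tau k x Q_(k-1)], expand the first term by the four-term
    recurrence and the second one by induction: the contributions of [P_(k-2)]
    cancel.  Predecessors are those of natural numbers, as every term of
    negative index has coefficient zero. *)
Lemma peel_three_term (R : rcfType) (alpha beta tau : R)
    (P : nat -> {poly R}) :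
  (forall k : nat, 'X * P k = P k.+1
     + (beta + tau * (2 * k%:R + alpha + 1)) *: P k
     + (2 * tau * beta * k%:R + tau ^+ 2 * k%:R * (k%:R + alpha)) *: P k.-1
     + (tau ^+ 2 * beta * k%:R * (k%:R - 1)) *: P k.-2) ->
  forall k : nat, 'X * peel (fun j => tau * j%:R) P k = P k.+1
     + (beta + tau * (k%:R + alpha + 1)) *: P k
     + (tau * beta * k%:R) *: P k.-1.
Proof.
move=> recP; elim=> [|k IHk]; first by rewrite /= recP -!mul_polyC; ring.
by rewrite [peel _ _ _]/= mulrBr recP -scalerAr IHk -!mul_polyC /=; ring.
Qed.

(** The factor removed here is chosen so that the contributions of [P_(k-1)]
    cancel in [x Q_k - s_k x N_(k-1)], where [s_k r_(k-1) = tau beta k]. *)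
Lemma peel_two_term (R : rcfType) (alpha beta tau : R) (P Q : nat -> {poly R}) :
  -1 < alpha -> 0 < beta -> 0 < tau ->
  (forall k : nat, 'X * Q k = P k.+1
     + (beta + tau * (k%:R + alpha + 1)) *: P k
     + (tau * beta * k%:R) *: P k.-1) ->
  let r := bidiag_coef alpha beta tau in
  forall k : nat,
    'X * peel (fun j => tau * beta * j%:R / r j.-1) Q k = P k.+1 + r k *: P k.
Proof.
move=> halpha beta_gt0 tau_gt0 recQ r.
elim=> [|k IHk]; first by rewrite /= recQ /r -!mul_polyC /=; ring.
have r_neq0 : r k != 0.
  by rewrite gt_eqF // (lt_trans beta_gt0) // bidiag_coef_gt.
rewrite [peel _ _ _]/= mulrBr recQ -scalerAr IHk scalerDr scalerA divfK //.
have -> : r k.+1 = beta + tau * (k.+1%:R + alpha + 1)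
    - tau * beta * k.+1%:R / r k by [].
by rewrite -!mul_polyC /=; ring.
Qed.

(** * Zeros of the generated polynomials *)

Lemma rootsR_prod_roots (R : rcfType) (s : seq R) :
  pos_decr s -> rootsR (prod_roots s) = rev s.
Proof.
move=> /andP[s_sorted _].
apply: (irr_sorted_eq lt_trans (@ltxx _ R)).
- exact: sorted_roots.
- by rewrite rev_sorted.
have s_neq0 : prod_roots s != 0 := monic_neq0 (monic_prod_roots s).
by move=> z; rewrite mem_rev -(roots_on_rootsR s_neq0) in_itv root_prod_XsubC.
Qed.

Lemma prod_roots_complex_zeros (R : realType) (s : seq R) :
  pos_decr s -> real_simple_positive_zeros (prod_roots s).
Proof.
move=> /andP[s_sorted s_pos] pC z.
have -> : pC = \prod_(y <- [seq real_complex R x | x <- s]) ('X - y%:P).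
  rewrite /pC rmorph_prod big_map; apply: eq_bigr => y _.
  by rewrite rmorphB /= map_polyX map_polyC.
rewrite root_prod_XsubC mu_prod_XsubC => zs.
have uniq_s : uniq s := sorted_uniq (rev_trans lt_trans) (@ltxx _ R) s_sorted.
split.
  by rewrite count_uniq_mem ?zs // map_inj_uniq //; exact: complexI.
by case/mapP: zs => x xs ->; exists x => //; exact: (allP s_pos).
Qed.

Theorem proposition1p3 (R : realType) (a alpha t T : R)
    (ha : 0 < a) (halpha : -1 < alpha) (ht : 0 < t) (htT : t < T)
    (B : int -> {poly R})
    (hB : generated_by_recurrence (coef_b a alpha t T) (coef_c a alpha t T)
            (coef_d a t T) B) :
  (forall k : nat, real_simple_positive_zeros (B k%:Z)) /\
  interlacing_property (fun k : nat => B k%:Z).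
Proof.
have [B0 Bm1 Bm2 recB] := hB.
have T_gt0 : 0 < T := lt_trans ht htT.
have T_neq0 : T != 0 by rewrite gt_eqF.
have Tt_gt0 : 0 < T - t by rewrite subr_gt0.
pose tau := 2 * t * (T - t) / T; pose beta := a * (T - t) ^+ 2 / T ^+ 2.
have tau_gt0 : 0 < tau by rewrite !(mulr_gt0, invr_gt0).
have beta_gt0 : 0 < beta by rewrite !(mulr_gt0, invr_gt0, exprn_gt0).
pose P (k : nat) := B k%:Z.
have recP k : 'X * P k = P k.+1
     + (beta + tau * (2 * k%:R + alpha + 1)) *: P k
     + (2 * tau * beta * k%:R + tau ^+ 2 * k%:R * (k%:R + alpha)) *: P k.-1
     + (tau ^+ 2 * beta * k%:R * (k%:R - 1)) *: P k.-2.
  (* At [k = 0] and [k = 1] the terms of negative index vanish on one side by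
     the initial values and on the other by their coefficients. *)
  have -> : 'X * P k = P k.+1 + coef_b a alpha t T k *: P k
      + coef_c a alpha t T k *: P k.-1 + coef_d a t T k *: P k.-2.
    rewrite /P recB -(addn1 k) PoszD; congr (_ + _ + _).
      case: k => [|k]; last by rewrite intS addrAC subrr add0r.
      by rewrite sub0r Bm1 scaler0 /coef_c !mulr0 mul0r addr0 scale0r.
    case: k => [|[|k]].
    - by rewrite sub0r Bm2 scaler0 /coef_d mulr0 mul0r scale0r.
    - have -> : 1%:Z - 2 = -1 :> int by [].
      by rewrite Bm1 scaler0 /coef_d subrr mulr0 scale0r.
    - by congr (_ *: B _); lia.
  have -> : coef_b a alpha t T k = beta + tau * (2 * k%:R + alpha + 1) by [].
  have -> : coef_c a alpha t T k =
      2 * tau * beta * k%:R + tau ^+ 2 * k%:R * (k%:R + alpha).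
    by rewrite /coef_c /tau /beta; field.
  have -> // : coef_d a t T k = tau ^+ 2 * beta * k%:R * (k%:R - 1).
  by rewrite /coef_d /tau /beta; field.
clearbody tau beta.
pose r := bidiag_coef alpha beta tau.
have r_gt0 k : 0 < r k.
  by rewrite (lt_trans beta_gt0) // bidiag_coef_gt.
pose Q := peel (fun j => tau * j%:R) P.
pose N := peel (fun j => tau * beta * j%:R / r j.-1) Q.
have XN k : 'X * N k = P k.+1 + r k *: P k.
  exact: peel_two_term halpha beta_gt0 tau_gt0 (peel_three_term recP) k.
have chain k : exists u w : seq R,
    [/\ size u = k /\ size w = k.+1, P k = prod_roots u, P k.+1 = prod_roots w,
        pos_decr u /\ pos_decr w & interlaced u w].
  apply: (@interlaced_chain _ P Q N (fun k => tau * k.+1%:R)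
    (fun k => tau * beta * k.+1%:R / r k) r) => // j; last by rewrite XN addrK.
    by rewrite mulr_gt0 ?ltr0n.
  by rewrite divr_gt0 ?mulr_gt0 ?ltr0n.
have B_roots k : exists2 u : seq R, size u = k &
    B k%:Z = prod_roots u /\ pos_decr u.
  by have [u [w [[size_u _] defP _ [u_pd _] _]]] := chain k; exists u.
split=> [k|]; first by have [u _ [-> /prod_roots_complex_zeros]] := B_roots k.
split=> [k _|k j k_gt0 /andP[j_gt0 le_jk]].
  by have [u <- [-> /rootsR_prod_roots->]] := B_roots k; rewrite size_rev.
have [u [w [[size_u size_w] defP defPS pd [_ lt_uw lt_wu]]]] := chain k.
have [u_pd w_pd] := pd.
rewrite /P in defP defPS; rewrite /= defP defPS !rootsR_prod_roots //.
rewrite !nth_rev ?size_u ?size_w; [|lia..].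
(* [rootsR] is increasing and indexed from 0, so the [j]-th zero of [B k] is
   the entry [k - j] of the decreasing list. *)
have -> : (k.+1 - (j - 1).+1 = (k - j).+1)%N by lia.
have -> : (k.+1 - (j.+1 - 1).+1 = k - j)%N by lia.
have -> : (k - (j - 1).+1 = k - j)%N by lia.
apply/andP; split; first by apply: lt_wu; rewrite size_w; lia.
by apply: lt_uw; rewrite size_u; lia.
Qed.
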